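(* Let $f:\mathbb{R}^n\to\mathbb{R}$ be convex, twice differentiable and bounded below, with $f^*:=\inf_x f(x)>-\infty$, and suppose that $\|\nabla^2 f(x)-\nabla^2 f(y)\|\le M\|x-y\|$ for all $x,y\in\mathbb{R}^n$, where $M>0$. Suppose there is a constant $D>0$ such that every $x$ with $f(x)\le f(x_0)$ satisfies $\|x-x^*\|\le D$, where $x^*$ is a minimizer of $f$. Then the adaptive universal trust-region method, started at $x_0\in\mathbb{R}^n$ with tolerance $\epsilon>0$, takes $$O\left(\rho_{\max}\,(f(x_0)-f^* )\,\log_{\gamma_1}\left(\rho_{\max}/\rho_{\min}\right)\,\epsilon^{-1/2}\right)$$ iterations to find an $\epsilon$-approximate solution, i.e. a point $x$ satisfying $f(x)-f^*\le O(\epsilon)$.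
   Context: Norms are the Euclidean norm for vectors and the induced operator norm for matrices; $\lambda_{\min}$ is the smallest eigenvalue. Subproblem. Given $x_k$, $\sigma\ge0$ and $r>0$: minimize $\tfrac12 d^T(\nabla^2 f(x_k)+\sigma\|\nabla f(x_k)\|^{1/2}I)d+\nabla f(x_k)^Td$ subject to $\|d\|\le r\|\nabla f(x_k)\|^{1/2}$. Adaptive universal trust-region method. Parameters: $x_0$, tolerance $\epsilon>0$, $0<\eta<\frac1{32}$, $\frac14<\xi<1$, initial penalty $\rho_0>0$, minimal penalty $\rho_{\min}>0$, $\gamma_1>1$, $\gamma_2>1$. For $k=0,1,\dots$ (outer loop): set $\rho_k^{(0)}=\rho_k$; for $j=0,1,\dots$ (inner loop): choose $(\sigma_k^{(j)},r_k^{(j)})$ by the strategy below, solve the subproblem with $\sigma=\sigma_k^{(j)}$, $r=r_k^{(j)}$ to get $d_k^{(j)}$, and leave the inner loop if the acceptance test below holds; otherwise set $\rho_k^{(j+1)}=\gamma_1\rho_k^{(j)}$. On leaving the inner loop set $x_{k+1}=x_k+d_k^{(j)}$, $\rho_{k+1}=\max\{\rho_{\min},\rho_k^{(j)}/\gamma_2\}$. The factor $\log_{\gamma_1}(\rho_{\max}/\rho_{\min})$ in the bound accounts for the inner iterations. Strategy. Write $g=\|\nabla f(x_k)\|$, $\rho=\rho_k^{(j)}$, $\ell=\lambda_{\min}(\nabla^2 f(x_k))$. - If $g\ge\epsilon$ and ($\ell\le-\rho g^{1/2}$ or $\ell\ge\rho g^{1/2}$): $\sigma_k^{(j)}=0$,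 $r_k^{(j)}=1/(2\rho)$. - If $g\ge\epsilon$ and $-\rho g^{1/2}<\ell<\rho g^{1/2}$: $\sigma_k^{(j)}=\rho$, $r_k^{(j)}=1/(4\rho)$. - If $g<\epsilon$ and $\ell>-\rho\epsilon^{1/2}$ (always the case for convex $f$ when $g<\epsilon$): the method terminates with output $x_k$. - If $g<\epsilon$ and $\ell\le-\rho\epsilon^{1/2}$ (never the case for convex $f$): $\sigma_k^{(j)}=0$, $r_k^{(j)}=\epsilon^{1/2}/(2\rho g^{1/2})$. Acceptance test for convex $f$ (with $d=d_k^{(j)}$): $f(x_k+d)\le f(x_k)$; if $g\ge\epsilon$, [$f(x_k+d)-f(x_k)\le-\frac{\eta}{\rho}g^{3/2}$ or $\|\nabla f(x_k+d)\|\le\xi g$]; if $g<\epsilon$, $f(x_k+d)-f(x_k)\le-\frac{\eta}{\rho}\epsilon^{3/2}$; and $\|\nabla f(x_k+d)\|\le\frac1\xi g$. Constant: $$\rho_{\max}:=\gamma_1\max\left\{\sqrt{\tfrac{M}{12(1-32\eta)}},\sqrt{\tfrac{M}{6(1-8\eta)}},\sqrt{\tfrac{M}{32\xi-8}},\sqrt{\tfrac{M}{8\xi}},\sqrt{\tfrac{M\xi}{8(1-\xi)}}\right\}.$$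
   Formalization: Assumes log_{γ1}(ρ_max/ρ_min) is positive (otherwise the bound is ≤ 0 and false); the O-constant may depend on the method's parameters, D, an upper bound on ‖∇f(x_0)‖, and positive lower bounds on f(x_0)−f* (if nonzero) and on this logarithm. *)

(* Defs.v *)
From HB Require Import structures.
From mathcomp Require Import all_boot all_order all_algebra.
From mathcomp Require Import all_classical all_reals all_analysis.

Set Implicit Arguments.
Unset Strict Implicit.
Unset Printing Implicit Defensive.

Import Order.TTheory GRing.Theory Num.Theory.
Import numFieldNormedType.Exports.

Local Open Scope classical_set_scope.
Local Open Scope ring_scope.

(* R^n (n >= 1) is the space 'rV[R]_n.+1 of row vectors.  The norm [`|_|] that
   the library puts on matrices is the sup norm, so the Euclidean norm and the
   operator norm that it induces are defined here.  Differentiability does not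
   depend on the choice of the norm. *)

Definition norm2 (R : realType) (n : nat) (v : 'rV[R]_n) : R :=
  Num.sqrt (\sum_i v 0 i ^+ 2).

Definition opnorm (R : realType) (n : nat) (A : 'M[R]_n) : R :=
  sup [set norm2 (v *m A) | v in [set v : 'rV[R]_n | norm2 v <= 1]].

Definition lambda_min (R : realType) (n : nat) (A : 'M[R]_n) : R :=
  inf [set a : R | eigenvalue A a].

Definition grad (R : realType) (n : nat) (f : 'rV[R]_n.+1 -> R)
    (x : 'rV[R]_n.+1) : 'rV[R]_n.+1 :=
  \row_i 'D_(delta_mx 0 i) f x.

Definition hess (R : realType) (n : nat) (f : 'rV[R]_n.+1 -> R)
    (x : 'rV[R]_n.+1) : 'M[R]_n.+1 :=
  jacobian (grad f) x.

Definition twice_differentiable (R : realType) (n : nat)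
    (f : 'rV[R]_n.+1 -> R) : Prop :=
  (forall x, differentiable f x) /\ (forall x, differentiable (grad f) x).

Definition model (R : realType) (n : nat) (f : 'rV[R]_n.+1 -> R)
    (x : 'rV[R]_n.+1) (sigma : R) (d : 'rV[R]_n.+1) : R :=
  2^-1 * (d *m (hess f x + (sigma * Num.sqrt (norm2 (grad f x)))%:M)
            *m d^T) 0 0
  + (grad f x *m d^T) 0 0.

Definition solves_subproblem (R : realType) (n : nat) (f : 'rV[R]_n.+1 -> R)
    (x : 'rV[R]_n.+1) (sigma r : R) (d : 'rV[R]_n.+1) : Prop :=
  let radius := r * Num.sqrt (norm2 (grad f x)) in
  norm2 d <= radius /\
  forall d', norm2 d' <= radius -> model f x sigma d <= model f x sigma d'.

(* [g] and [l] stand for the gradient norm and the smallest eigenvalue of the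
   Hessian at the current point; the result is the pair (sigma, r), or [None]
   when the method terminates. *)
Definition strategy (R : realType) (eps rho g l : R) : option (R * R) :=
  if eps <= g then
    if (l <= - (rho * Num.sqrt g)) || (rho * Num.sqrt g <= l)
    then Some (0, (2 * rho)^-1)
    else Some (rho, (4 * rho)^-1)
  else
    if - (rho * Num.sqrt eps) < l
    then None
    else Some (0, Num.sqrt eps / (2 * rho * Num.sqrt g)).

Definition strategy_at (R : realType) (n : nat) (f : 'rV[R]_n.+1 -> R)
    (eps rho : R) (x : 'rV[R]_n.+1) : option (R * R) :=
  strategy eps rho (norm2 (grad f x)) (lambda_min (hess f x)).

Definition accept (R : realType) (n : nat) (f : 'rV[R]_n.+1 -> R)
    (eta xi eps rho : R) (x d : 'rV[R]_n.+1) : bool :=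
  let g := norm2 (grad f x) in
  [&& f (x + d) <= f x,
      (if eps <= g then
         (f (x + d) - f x <= - (eta / rho * g `^ (3 / 2)))
         || (norm2 (grad f (x + d)) <= xi * g)
       else f (x + d) - f x <= - (eta / rho * eps `^ (3 / 2)))
    & norm2 (grad f (x + d)) <= xi^-1 * g].

(* The two nested loops are run as a single sequence: [t] counts the inner
   iterations (that is, the subproblems solved) over all outer iterations,
   [x t] is the current outer iterate and [rho t] the current rho_k^(j).  An
   accepted step starts the next outer iteration, a rejected one the next
   inner iteration.  A terminated run stays where it is, so its output is the
   value of [x] at the first [t] with [strategy_at] equal to [None]. *)
Definition method_run (R : realType) (n : nat) (f : 'rV[R]_n.+1 -> R)
    (eta xi rho0 rhomin gamma1 gamma2 eps : R) (x0 : 'rV[R]_n.+1)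
    (x d : nat -> 'rV[R]_n.+1) (rho : nat -> R) : Prop :=
  [/\ x 0%N = x0, rho 0%N = rho0 &
    forall t : nat,
      match strategy_at f eps (rho t) (x t) with
      | None => x t.+1 = x t /\ rho t.+1 = rho t
      | Some (sigma, r) =>
          solves_subproblem f (x t) sigma r (d t) /\
          if accept f eta xi eps (rho t) (x t) (d t)
          then x t.+1 = x t + d t /\ rho t.+1 = Num.max rhomin (rho t / gamma2)
          else x t.+1 = x t /\ rho t.+1 = gamma1 * rho t
      end].

Definition rho_max (R : realType) (eta xi gamma1 M : R) : R :=
  gamma1 *
  Num.max (Num.sqrt (M / (12 * (1 - 32 * eta))))
 (Num.max (Num.sqrt (M / (6 * (1 - 8 * eta))))
 (Num.max (Num.sqrt (M / (32 * xi - 8)))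
 (Num.max (Num.sqrt (M / (8 * xi)))
          (Num.sqrt (M * xi / (8 * (1 - xi))))))).

Definition log_base (R : realType) (b a : R) : R := ln a / ln b.

(* Main.v *)
Require Import Defs.
From HB Require Import structures.
From mathcomp Require Import all_boot all_order all_algebra.
From mathcomp Require Import all_classical all_reals all_analysis.
From mathcomp Require Import ring lra.

Import Order.TTheory GRing.Theory Num.Theory.
Import numFieldNormedType.Exports.
Local Open Scope classical_set_scope.
Local Open Scope ring_scope.
Set Implicit Arguments.
Unset Strict Implicit.
Unset Printing Implicit Defensive.

(** The proof has a local part, on one trust-region step, and a global part,
    which counts iterations with a potential function.

    Local part.  Write [s] for the square root of the gradient norm at the
    current point.  Convexity makes the Hessian positive semidefinite, so after
    the regularization chosen by the strategy the model is strongly convex with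
    modulus at least [rho * s], and its minimizer [d] on the ball satisfies
    [grad f x + d H = - nu d] with [nu >= 0] ([subproblem_multiplier]).  There
    are two cases.  If [d] lies on the boundary, of radius proportional to
    [s / rho], then the second-order Taylor bound gives a decrease of order
    [s ^ 3 / rho].  Otherwise the multiplier is zero, and [grad f (x + d)]
    consists of the regularization term and a Taylor remainder, which together
    are at most [xi] times the old gradient norm.  In both cases the remainder
    is controlled as soon as [rho >= rho_max / gamma1]: such a step is accepted
    ([accept_large_rho]).  Hence a rejection can happen only below that value,
    and the penalty stays below a fixed multiple of [rho_max].

    Global part.  While the gradient norm [gn] is at least [eps], convexity and
    the diameter bound give [f x - f* <= D * gn], so a decrease of order
    [gn ^ (3 / 2) / rho] makes [gap + D * eps] obey a discrete version of
    [u' = - c u ^ (3 / 2)]: the quantity [(gap + D * eps) ^ (- 1 / 2)] grows by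
    a constant at each such step, and it never exceeds [(D * eps) ^ (- 1 / 2)].
    The other accepted steps shrink [ln gn] by a constant, and a rejection
    raises [ln rho] by [ln gamma1].  A decrease step raises [ln gn], and any
    accepted step lowers [ln rho], only by constants, so a suitable combination
    of the three quantities drops by at least 1 at every iteration
    ([potential_iteration]).  The range of this potential is
    [O (rho_max * eps ^ (- 1 / 2) + ln (G / eps) + log (rho_max / rhomin))],
    and each summand is absorbed by the claimed bound because
    [eps <= G] until termination, [rhomin <= rho_max], and the initial gap and
    the logarithm are at least [delta] ([iteration_bound]).

    When the gradient norm falls below [eps] the method stops, the smallest
    eigenvalue being nonnegative, and then [f x - f* <= D * eps]. *)

(** * Euclidean geometry of row vectors *)

Definition dot (R : realType) (n : nat) (u v : 'rV[R]_n) : R := (u *m v^T) 0 0.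

Section Euclidean.
Context {R : realType} {n : nat}.
Implicit Types (u v w : 'rV[R]_n) (a : R).

Lemma dotE u v : dot u v = \sum_i u 0 i * v 0 i.
Proof. by rewrite /dot mxE; apply: eq_bigr => i _; rewrite mxE. Qed.

Lemma dotC u v : dot u v = dot v u.
Proof. by rewrite !dotE; apply: eq_bigr => i _; rewrite mulrC. Qed.

Lemma dotDl u v w : dot (u + v) w = dot u w + dot v w.
Proof. by rewrite /dot mulmxDl mxE. Qed.

Lemma dotZl a u v : dot (a *: u) v = a * dot u v.
Proof. by rewrite /dot -scalemxAl mxE. Qed.

Lemma dotNl u v : dot (- u) v = - dot u v.
Proof. by rewrite -scaleN1r dotZl mulN1r. Qed.

Lemma dotDr u v w : dot u (v + w) = dot u v + dot u w.
Proof. by rewrite dotC dotDl !(dotC _ u). Qed.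

Lemma dotZr a u v : dot u (a *: v) = a * dot u v.
Proof. by rewrite dotC dotZl dotC. Qed.

Lemma dotNr u v : dot u (- v) = - dot u v.
Proof. by rewrite dotC dotNl dotC. Qed.

Definition dot_lin := (dotDl, dotDr, dotZl, dotZr, dotNl, dotNr).

Lemma dot0l v : dot 0 v = 0.
Proof. by rewrite -(scale0r v) dotZl mul0r. Qed.

Lemma dot_ge0 v : 0 <= dot v v.
Proof. by rewrite dotE; apply: sumr_ge0 => i _; rewrite -expr2 sqr_ge0. Qed.

Lemma norm2_ge0 v : 0 <= norm2 v.
Proof. exact: sqrtr_ge0. Qed.

Lemma norm2E v : norm2 v = Num.sqrt (dot v v).
Proof. by rewrite dotE. Qed.

Lemma sqr_norm2 v : norm2 v ^+ 2 = dot v v.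
Proof. by rewrite norm2E sqr_sqrtr ?dot_ge0. Qed.

Lemma dot_eq0 v : dot v v = 0 -> v = 0.
Proof.
move=> /eqP; rewrite dotE psumr_eq0 => [/allP v0|i _]; last by rewrite -expr2 sqr_ge0.
apply/rowP => i; rewrite mxE; apply/eqP.
by have := v0 i (mem_index_enum _); rewrite mulf_eq0 orbb.
Qed.

Lemma norm2_eq0 v : norm2 v = 0 -> v = 0.
Proof. by move=> v0; apply: dot_eq0; rewrite -sqr_norm2 v0 expr0n. Qed.

Lemma norm2_0 : norm2 (0 : 'rV[R]_n) = 0.
Proof. by rewrite norm2E dot0l sqrtr0. Qed.

Lemma norm2Z a v : norm2 (a *: v) = `|a| * norm2 v.
Proof. by rewrite !norm2E !dot_lin mulrA -expr2 sqrtrM ?sqr_ge0// sqrtr_sqr. Qed.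

Lemma norm2N v : norm2 (- v) = norm2 v.
Proof. by rewrite -scaleN1r norm2Z normrN1 mul1r. Qed.

Lemma dot_le_norm2 u v : dot u v <= norm2 u * norm2 v.
Proof.
have [a0|a0] := eqVneq (norm2 u) 0.
  by rewrite a0 (norm2_eq0 a0) dot0l mul0r.
have [b0|b0] := eqVneq (norm2 v) 0.
  by rewrite b0 (norm2_eq0 b0) dotC dot0l mulr0.
have ap : 0 < norm2 u by rewrite lt_neqAle eq_sym a0 norm2_ge0.
have bp : 0 < norm2 v by rewrite lt_neqAle eq_sym b0 norm2_ge0.
have := dot_ge0 (norm2 v *: u - norm2 u *: v).
rewrite !dot_lin (dotC v u) -!sqr_norm2.
move: (norm2 u) (norm2 v) (dot u v) ap bp => a b c ap bp h.
have : 0 <= (a * b) * (a * b - c) by nra.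
by rewrite pmulr_rge0 ?mulr_gt0// subr_ge0.
Qed.

Lemma ler_norm2D u v : norm2 (u + v) <= norm2 u + norm2 v.
Proof.
rewrite -(@ler_pXn2r _ 2) ?nnegrE ?addr_ge0 ?norm2_ge0//.
rewrite sqr_norm2 !dot_lin (dotC v u) -!sqr_norm2.
by have := dot_le_norm2 u v; nra.
Qed.

(** Testing against every direction bounds the Euclidean norm, which turns
    scalar estimates along a direction into vector estimates. *)
Lemma norm2_le_dual v a : 0 <= a ->
  (forall w, dot v w <= a * norm2 w) -> norm2 v <= a.
Proof.
move=> a0 /(_ v); rewrite -sqr_norm2.
have [->//|v0] := eqVneq (norm2 v) 0.
have vp : 0 < norm2 v by rewrite lt_neqAle eq_sym v0 norm2_ge0.
by rewrite expr2 ler_pM2r.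
Qed.

(** Makes the supremum in [opnorm] a genuine least upper bound rather than the
    default value of [sup]. *)
Lemma opnorm_bounded (A : 'M[R]_n) :
  has_ubound [set norm2 (v *m A) | v in [set v : 'rV[R]_n | norm2 v <= 1]].
Proof.
exists (Num.sqrt (\sum_j norm2 (col j A)^T ^+ 2)) => _ [v /= v1 <-].
rewrite norm2E; apply: ler_wsqrtr; rewrite dotE; apply: ler_sum => j _.
have -> : (v *m A) 0 j = dot v (col j A)^T.
  by rewrite mxE dotE; apply: eq_bigr => i _; rewrite !mxE.
rewrite -expr2 -ler_sqrt ?exprn_ge0 ?norm2_ge0// !sqrtr_sqr.
rewrite (ger0_norm (norm2_ge0 _)) ler_norml; apply/andP; split.
  rewrite lerNl -dotNl (le_trans (dot_le_norm2 _ _))// norm2N.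
  by rewrite ler_piMl ?norm2_ge0.
by rewrite (le_trans (dot_le_norm2 _ _))// ler_piMl ?norm2_ge0.
Qed.

Lemma norm2_mulmx_le (A : 'M[R]_n) v : norm2 (v *m A) <= opnorm A * norm2 v.
Proof.
have [v0|v0] := eqVneq (norm2 v) 0.
  by rewrite v0 mulr0 (norm2_eq0 v0) mul0mx norm2_0.
have vp : 0 < norm2 v by rewrite lt_neqAle eq_sym v0 norm2_ge0.
rewrite -ler_pdivrMr// mulrC.
have -> : (norm2 v)^-1 * norm2 (v *m A) = norm2 (((norm2 v)^-1 *: v) *m A).
  by rewrite -scalemxAl norm2Z ger0_norm ?invr_ge0 ?norm2_ge0.
apply: (ub_le_sup (opnorm_bounded A)); exists ((norm2 v)^-1 *: v) => //=.
by rewrite norm2Z ger0_norm ?invr_ge0 ?norm2_ge0// mulVf.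
Qed.

End Euclidean.

(** * Second-order Taylor estimates *)

Section OneVariable.
Context {R : realType}.
Implicit Types (phi dphi : R -> R) (a b c t : R).

(** A bound on the derivative is integrated without integrals: [phi] minus the
    cubic with the bounding derivative is nonincreasing. *)
Lemma growth_le_cubic phi dphi a b c :
  (forall t, is_derive t 1 phi (dphi t)) ->
  (forall t, 0 < t -> t < 1 -> dphi t <= a + 2 * b * t + 3 * c * t ^+ 2) ->
  phi 1 - phi 0 <= a + b + c.
Proof.
move=> phiD dphi_le.
pose p : R -> R := a \*: id + b \*: id ^+ 2 + c \*: id ^+ 3.
have pE t : p t = a * t + b * t ^+ 2 + c * t ^+ 3 by rewrite /p !fctE.
have pD t : is_derive t 1 p (a + 2 * b * t + 3 * c * t ^+ 2).
  have D k := is_deriveX k (is_derive_id t (1 : R)).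
  have Dp := is_deriveD (is_deriveD (is_deriveZ a (is_derive_id t (1 : R)))
    (is_deriveZ b (D 2%N))) (is_deriveZ c (D 3%N)).
  by apply: (is_derive_eq Dp); rewrite /GRing.scale /=; ring.
have psiD t : is_derive t 1 (phi - p) (dphi t - (a + 2 * b * t + 3 * c * t ^+ 2)).
  exact: is_deriveB.
have : (phi - p) 1 <= (phi - p) 0.
  apply: (@ler0_derive1_le_cc R (phi - p) 0 1);
    rewrite ?in_itv/= ?lexx ?ler01//.
  - move=> t; rewrite in_itv/= => /andP[t0 t1].
    by rewrite derive1E (@derive_val _ _ _ _ _ _ _ (psiD t)) subr_le0 dphi_le.
  - by apply: derivable_within_continuous => t _; have [] := psiD t.
rewrite !fctE !pE; lra.
Qed.

(** Each of the three expansions below is the growth over [0, 1] of a function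
    whose derivative is affine up to an error of degree 0, 1 or 2. *)
Lemma growth_approx phi dphi p0 p1 a b e0 e1 e2 :
  phi 0 = p0 -> phi 1 = p1 ->
  (forall t, is_derive t 1 phi (dphi t)) ->
  (forall t, 0 < t -> t < 1 ->
     `|dphi t - (a + 2 * b * t)| <= e0 + 2 * e1 * t + 3 * e2 * t ^+ 2) ->
  `|p1 - p0 - (a + b)| <= e0 + e1 + e2.
Proof.
move=> <- <- phiD dphi_le; rewrite ler_norml; apply/andP; split.
  have := @growth_le_cubic (- phi) (- dphi) (- a + e0) (- b + e1) e2.
  rewrite !fctE => h; suff: - phi 1 - - phi 0 <= - a + e0 + (- b + e1) + e2 by lra.
  apply: h => t t0 t1.
  have := dphi_le t t0 t1; rewrite ler_norml; lra.
have h := @growth_le_cubic phi dphi (a + e0) (b + e1) e2.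
suff: phi 1 - phi 0 <= a + e0 + (b + e1) + e2 by lra.
apply: h => t t0 t1; have := dphi_le t t0 t1; rewrite ler_norml; lra.
Qed.

(** Letting [t] tend to 0; all first-order conditions below are obtained by
    dividing an expansion by a power of [t] and appealing to this lemma. *)
Lemma ge0_of_linear_lbound a b :
  (forall t, 0 < t -> t <= 1 -> 0 <= a + t * b) -> 0 <= a.
Proof.
move=> h; rewrite leNgt; apply/negP => a0.
pose t := Num.min 1 (- a / (2 * (`|b| + 1))).
have b0 := normr_ge0 b.
have q0 : 0 < - a / (2 * (`|b| + 1)) by apply: divr_gt0; lra.
have t0 : 0 < t by rewrite lt_min ltr01.
have t1 : t <= 1 by rewrite ge_min lexx.
have tb : t * (`|b| + 1) <= - a / 2.
  have -> : - a / 2 = - a / (2 * (`|b| + 1)) * (`|b| + 1) by field; lra.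
  by rewrite ler_wpM2r ?ge_min ?lexx ?orbT//; lra.
have := h t t0 t1; have := ler_norm b; nra.
Qed.

End OneVariable.

Section Lines.
Context {R : realType} {n : nat}.
Implicit Types (f : 'rV[R]_n.+1 -> R) (x d w : 'rV[R]_n.+1) (t : R).

Lemma is_derive_along (W : normedModType R) (F : 'rV[R]_n.+1 -> W) x d t :
  differentiable F (x + t *: d) ->
  is_derive t 1 (fun s => F (x + s *: d)) ('D_d F (x + t *: d)).
Proof.
move=> dF0; have dF : derivable F (x + t *: d) d by exact: diff_derivable.
have E : (fun h => h^-1 *: (((fun s : R => F (x + s *: d)) \o shift t) (h *: (1 : R)) -
            F (x + t *: d))) =
         (fun h => h^-1 *: ((F \o shift (x + t *: d)) (h *: d) - F (x + t *: d))).
  apply/funext => h /=; congr (_ *: (F _ - _)).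
  by rewrite [_%:A]mulr1 scalerDl addrCA.
apply: DeriveDef; first by rewrite /derivable E.
by rewrite /derive E.
Qed.

Lemma derive_grad f x d : differentiable f x -> 'D_d f x = dot (grad f x) d.
Proof.
move=> df; rewrite deriveE// {1}(row_sum_delta d) linear_sum dotE.
by apply: eq_bigr => i _; rewrite linearZ /= mxE deriveE// mulrC.
Qed.

Lemma is_derive_line f x d t : differentiable f (x + t *: d) ->
  is_derive t 1 (fun s => f (x + s *: d)) (dot (grad f (x + t *: d)) d).
Proof. by move=> df; rewrite -derive_grad//; exact: is_derive_along. Qed.

Lemma is_derive_grad_line f x d w t :
  differentiable (grad f) (x + t *: d) ->
  is_derive t 1 (fun s => dot (grad f (x + s *: d)) w)
    (dot (d *m hess f (x + t *: d)) w).
Proof.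
move=> df; have [dg Dg] := is_derive_along df.
rewrite deriveEjacobian// in Dg.
have -> : (fun s => dot (grad f (x + s *: d)) w) =
    \sum_i (w 0 i \*: (fun s => grad f (x + s *: d) 0 i)).
  apply/funext => s; rewrite fct_sumE dotE; apply: eq_bigr => i _.
  by rewrite mulrC.
have -> : dot (d *m hess f (x + t *: d)) w =
    \sum_i w 0 i *: (d *m hess f (x + t *: d)) 0 i.
  by rewrite dotE; apply: eq_bigr => i _; rewrite mulrC.
apply: is_derive_sum => i; apply: is_deriveZ.
apply: DeriveDef.
  exact: ((derivable_mxP (fun s : R => grad f (x + s *: d)) t 1).1 dg 0 i).
by have := derive_mx dg; rewrite Dg => /rowP/(_ i); rewrite [RHS]mxE => <-.
Qed.

End Lines.

(** Gradient and Hessian matter only through their derivatives along lines, so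
    [g] and [H] stand for them from here on. *)
Section Taylor.
Context {R : realType} {n : nat} (f : 'rV[R]_n.+1 -> R)
  (g : 'rV[R]_n.+1 -> 'rV[R]_n.+1) (H : 'rV[R]_n.+1 -> 'M[R]_n.+1) (M : R).
Hypothesis f_line : forall x d (t : R),
  is_derive t 1 (fun s => f (x + s *: d)) (dot (g (x + t *: d)) d).
Hypothesis g_line : forall x d w (t : R),
  is_derive t 1 (fun s => dot (g (x + s *: d)) w)
    (dot (d *m H (x + t *: d)) w).
Hypothesis M0 : 0 < M.
Hypothesis H_lip : forall x y, opnorm (H x - H y) <= M * norm2 (x - y).
Implicit Types (x a b d v w : 'rV[R]_n.+1).

Lemma dot_grad_taylor x d w :
  `|dot (g (x + d)) w - dot (g x) w - dot (d *m H x) w|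
    <= M / 2 * norm2 d ^+ 2 * norm2 w.
Proof.
rewrite -[X in _ - X]addr0 -[leRHS]add0r -[leRHS]addr0.
apply: (@growth_approx R (fun s => dot (g (x + s *: d)) w)
  (fun t => dot (d *m H (x + t *: d)) w)) => [||t t0 t1].
- by rewrite scale0r addr0.
- by rewrite scale1r.
have hle : norm2 (d *m (H (x + t *: d) - H x)) <=
    M * (t * norm2 d) * norm2 d.
  apply: (le_trans (norm2_mulmx_le _ _)); rewrite ler_wpM2r ?norm2_ge0//.
  apply: (le_trans (H_lip _ _)).
  by rewrite addrAC subrr add0r norm2Z gtr0_norm.
have : norm2 (d *m (H (x + t *: d) - H x)) * norm2 w <=
    M * (t * norm2 d) * norm2 d * norm2 w.
  by rewrite ler_wpM2r ?norm2_ge0.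
have := dot_le_norm2 (d *m (H (x + t *: d) - H x)) w.
have := dot_le_norm2 (d *m (H (x + t *: d) - H x)) (- w).
rewrite norm2N mulmxBr !dot_lin ler_norml; lra.
Qed.

Lemma grad_taylor x d :
  norm2 (g (x + d) - g x - d *m H x) <= M / 2 * norm2 d ^+ 2.
Proof.
apply: norm2_le_dual => [|w].
  by rewrite mulr_ge0 ?sqr_ge0// ltW// divr_gt0.
by apply: le_trans (dot_grad_taylor x d w); rewrite !dot_lin ler_norm.
Qed.

Lemma taylor2 x d :
  `|f (x + d) - f x - (dot (g x) d + dot (d *m H x) d / 2)|
    <= M / 6 * norm2 d ^+ 3.
Proof.
rewrite -[leRHS]add0r -[X in X + M / 6 * _]addr0.
apply: (@growth_approx R (fun s => f (x + s *: d))
  (fun t => dot (g (x + t *: d)) d)) => [||t t0 t1].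
- by rewrite scale0r addr0.
- by rewrite scale1r.
have := dot_grad_taylor x (t *: d) d.
rewrite norm2Z (gtr0_norm t0) -scalemxAl !dot_lin !ler_norml; lra.
Qed.

(** The second difference is the growth of [s |-> f (x + b + s *: a) -
    f (x + s *: a)], whose derivative is a difference of two gradients. *)
Lemma second_difference x a b :
  `|f (x + b + a) - f (x + a) - (f (x + b) - f x) - dot (b *m H x) a|
    <= M * (norm2 a + norm2 b) ^+ 2 * norm2 a.
Proof.
rewrite -[X in _ - X]addr0 -[leRHS]addr0 -[leRHS]addr0.
apply: (@growth_approx R
  ((fun s => f (x + b + s *: a)) - (fun s => f (x + s *: a)))
  (fun t => dot (g (x + b + t *: a)) a - dot (g (x + t *: a)) a))
  => [||t t0 t1].
- by rewrite !fctE scale0r !addr0.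
- by rewrite !fctE scale1r.
have e1 := dot_grad_taylor x (b + t *: a) a.
have e2 := dot_grad_taylor x (t *: a) a.
have na := norm2_ge0 a; have nb := norm2_ge0 b.
have nba : norm2 (b + t *: a) <= norm2 a + norm2 b.
  rewrite (le_trans (ler_norm2D _ _))// norm2Z gtr0_norm// addrC lerD2r.
  by rewrite ler_piMl// ltW.
have {}nba : norm2 (b + t *: a) ^+ 2 <= (norm2 a + norm2 b) ^+ 2.
  by rewrite lerXn2r ?nnegrE ?norm2_ge0 ?addr_ge0.
have nta : norm2 (t *: a) ^+ 2 <= (norm2 a + norm2 b) ^+ 2.
  rewrite lerXn2r ?nnegrE ?norm2_ge0 ?addr_ge0// norm2Z gtr0_norm//.
  by rewrite (@le_trans _ _ (norm2 a))// ?ler_piMl ?lerDl// ltW.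
have {}nba : M / 2 * norm2 (b + t *: a) ^+ 2 * norm2 a <=
             M / 2 * (norm2 a + norm2 b) ^+ 2 * norm2 a.
  by rewrite ler_wpM2r// ler_wpM2l// ltW// divr_gt0.
have {}nta : M / 2 * norm2 (t *: a) ^+ 2 * norm2 a <=
             M / 2 * (norm2 a + norm2 b) ^+ 2 * norm2 a.
  by rewrite ler_wpM2r// ler_wpM2l// ltW// divr_gt0.
move: e1 e2; rewrite addrA mulmxDl !dot_lin !ler_norml; lra.
Qed.

(** The second difference of [f] is symmetric in its two increments, and by
    [second_difference] the Hessian recovers it up to a third-order error; so
    scaling both increments by [t -> 0] forces the Hessian to be symmetric. *)
Lemma hess_sym x a b : dot (a *m H x) b = dot (b *m H x) a.
Proof.
suff le_sym u v : dot (u *m H x) v <= dot (v *m H x) u.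
  by apply/le_anti; rewrite !le_sym.
rewrite -subr_ge0.
apply: (@ge0_of_linear_lbound _ _
  (M * (norm2 u + norm2 v) ^+ 2 * (norm2 u + norm2 v))) => t t0 t1.
have := second_difference x (t *: u) (t *: v).
have := second_difference x (t *: v) (t *: u).
rewrite !norm2Z (gtr0_norm t0) -!scalemxAl !dot_lin (addrAC x (t *: v)).
rewrite !ler_norml => /andP[h1 h2] /andP[h3 h4].
rewrite -(pmulr_rge0 _ (exprn_gt0 2 t0)); lra.
Qed.

(** A step of length proportional to [t] against the gradient changes [f] by
    [- t * |g x| ^ 2] up to an error of order [t ^ 2]. *)
Lemma grad_minimizer x : (forall y, f x <= f y) -> g x = 0.
Proof.
move=> x_min; apply/dot_eq0/le_anti; rewrite dot_ge0 andbT -oppr_ge0.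
apply: (@ge0_of_linear_lbound _ _
  (`|dot (g x *m H x) (g x) / 2| + M / 6 * norm2 (g x) ^+ 3)) => t t0 t1.
have := x_min (x + - t *: g x); have := taylor2 x (- t *: g x).
rewrite norm2Z normrN (gtr0_norm t0) -!scalemxAl !(dotZl, dotZr) ler_norml.
move=> /andP[_ h] h0.
have N0 : 0 <= M / 6 * norm2 (g x) ^+ 3.
  by rewrite mulr_ge0 ?exprn_ge0 ?norm2_ge0// ltW// divr_gt0.
have t3 : t ^+ 3 <= t ^+ 2 by rewrite ler_wiXn2l// ltW.
have q := ler_wpM2l (sqr_ge0 t) (ler_norm (dot (g x *m H x) (g x) / 2)).
rewrite -(pmulr_rge0 _ t0); have := ler_wpM2r N0 t3; lra.
Qed.

(** * Convexity *)

Hypothesis f_convex : forall x v (t : R), 0 <= t -> t <= 1 ->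
  f (x + t *: v) <= f x + t * (f (x + v) - f x).

(** Expanding [f (x + t *: v)] in the convexity inequality on the segment and
    dividing by [t] leaves the tangent inequality plus an error of order [t]. *)
Lemma convex_grad_ineq x v : f x + dot (g x) v <= f (x + v).
Proof.
suff : 0 <= f (x + v) - f x - dot (g x) v by lra.
apply: (@ge0_of_linear_lbound _ _
  (M / 6 * norm2 v ^+ 3 - dot (v *m H x) v / 2)) => t t0 t1.
have := f_convex x v (ltW t0) t1; have := taylor2 x (t *: v).
rewrite norm2Z (gtr0_norm t0) -!scalemxAl !dot_lin ler_norml => /andP[h _] hc.
have N0 : 0 <= M / 6 * norm2 v ^+ 3.
  by rewrite mulr_ge0 ?exprn_ge0 ?norm2_ge0// ltW// divr_gt0.
have t3 : t ^+ 3 <= t ^+ 2 by rewrite ler_wiXn2l// ltW.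
rewrite -(pmulr_rge0 _ t0); have := ler_wpM2r N0 t3; lra.
Qed.

(** At [x + t *: v] the tangent inequality cancels the first-order term of the
    expansion, which leaves the quadratic term up to an error of order [t ^ 3]. *)
Lemma convex_hess_psd x v : 0 <= dot (v *m H x) v.
Proof.
suff : 0 <= dot (v *m H x) v / 2 by lra.
apply: (@ge0_of_linear_lbound _ _ (M / 6 * norm2 v ^+ 3)) => t t0 t1.
have := convex_grad_ineq x (t *: v); have := taylor2 x (t *: v).
rewrite norm2Z (gtr0_norm t0) -!scalemxAl !dot_lin ler_norml => /andP[_ h] hc.
rewrite -(pmulr_rge0 _ (exprn_gt0 2 t0)); lra.
Qed.

End Taylor.

(** * The smallest eigenvalue of a symmetric matrix *)

Section SmallestEigenvalue.
Context {R : realType} {n : nat} (A : 'M[R]_n.+1).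
Hypothesis A_sym : forall a b, dot (a *m A) b = dot (b *m A) a.
Implicit Types (u v w : 'rV[R]_n.+1).

Lemma continuous_quadratic (B : 'M[R]_n.+1) :
  continuous (fun v : 'rV[R]_n.+1 => dot (v *m B) v).
Proof.
have -> : (fun v => dot (v *m B) v) =
    \sum_i \sum_j (fun v : 'rV[R]_n.+1 => v 0 j * (B j i * v 0 i)).
  apply/funext => v; rewrite fct_sumE dotE; apply: eq_bigr => i _.
  by rewrite fct_sumE mxE mulr_suml; apply: eq_bigr => j _; rewrite mulrA.
move=> v; apply: differentiable_continuous.
apply: differentiable_sum => i; apply: differentiable_sum => j.
apply: differentiableM; first exact: differentiable_coord.
by apply: differentiableM => //; exact: differentiable_coord.
Qed.

Lemma unit_sphere_compact : compact [set v : 'rV[R]_n.+1 | dot v v = 1].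
Proof.
apply: bounded_closed_compact.
  exists 1; split; first exact: num_real.
  move=> K K1 v /= v1; apply/ltW; apply: le_lt_trans K1.
  rewrite /Num.Def.normr /= mx_normrE; apply: bigmax_le => // -[i j] _ /=.
  rewrite ord1 -(@ler_pXn2r _ 2) ?nnegrE// expr1n real_normK ?num_real//.
  rewrite -v1 dotE (bigD1 j)//= -expr2 lerDl.
  by apply: sumr_ge0 => k _; rewrite -expr2 sqr_ge0.
rewrite (_ : [set v | _] =
    (fun v : 'rV[R]_n.+1 => dot (v *m 1%:M) v) @^-1` [set 1]); last first.
  by apply/seteqP; split => v /=; rewrite mulmx1.
by apply: closed_comp => [v _|]; [exact: continuous_quadratic | exact: closed_eq].
Qed.

Lemma rayleigh_min : exists u, dot u u = 1 /\
  forall v, dot (u *m A) u * dot v v <= dot (v *m A) v.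
Proof.
have [||u] := @compact_EVT_min _ R (fun v => dot (v *m A) v) _ _
  unit_sphere_compact.
- exists (delta_mx 0 0); rewrite /= dotE (bigD1 0)//= big1 => [|i i0].
    by rewrite !mxE !eqxx mulr1 addr0.
  by rewrite !mxE (negbTE i0) andbF mul0r.
- exact/continuous_subspaceT/continuous_quadratic.
rewrite inE /= => u1 umin; exists u; split=> // v.
have [v0|v0] := eqVneq (norm2 v) 0.
  by rewrite (norm2_eq0 v0) dot0l mulr0 mul0mx dot0l.
have vp : 0 < norm2 v by rewrite lt_neqAle eq_sym v0 norm2_ge0.
have := umin ((norm2 v)^-1 *: v); rewrite inE /= !dot_lin -!scalemxAl !dot_lin.
rewrite -!sqr_norm2 => h.
have {}h := h ltac:(by field).
rewrite mulrC -ler_pdivlMl ?exprn_gt0//; apply: le_trans h _.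
by rewrite le_eqVlt; apply/orP; left; apply/eqP; field.
Qed.

(** A vector on which a positive semidefinite form vanishes lies in its kernel.
    For [A - m] with [m] the least Rayleigh quotient, this makes a minimizer [u]
    an eigenvector; so the infimum of the eigenvalues is attained at [m]. *)
Lemma lambda_minP : exists u, [/\ dot u u = 1,
  lambda_min A = dot (u *m A) u &
  forall v, lambda_min A * dot v v <= dot (v *m A) v].
Proof.
have [u [u1 umin]] := rayleigh_min; set m := dot (u *m A) u in umin *.
have cross v : 0 <= dot (u *m A) v - m * dot u v.
  suff : 0 <= 2 * (dot (u *m A) v - m * dot u v) by lra.
  apply: (@ge0_of_linear_lbound _ _ (dot (v *m A) v - m * dot v v)) => t t0 t1.
  have := umin (u + t *: v).
  rewrite mulmxDl -!scalemxAl !dot_lin (A_sym v u) (dotC v u) u1 -/m => h.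
  rewrite -(pmulr_rge0 _ t0); lra.
have eigen_u : u *m A = m *: u.
  apply/eqP; rewrite -subr_eq0; apply/eqP/dot_eq0.
  have h w : dot (u *m A - m *: u) w = 0.
    have := cross w; have := cross (- w); rewrite !dot_lin; lra.
  exact: h.
have eig_ge : lbound [set a : R | eigenvalue A a] m.
  move=> a /= /eigenvalueP[v va v0]; have := umin v.
  rewrite va dot_lin ler_pM2r// lt_neqAle dot_ge0 andbT eq_sym.
  by apply: contra v0 => /eqP/dot_eq0 ->.
have u0 : u != 0.
  by apply: contra_eq_neq u1 => ->; rewrite dot0l eq_sym oner_neq0.
have eig_m : eigenvalue A m by apply/eigenvalueP; exists u.
have -> : lambda_min A = m.
  apply/le_anti/andP; split; first by apply: ge_inf; first by exists m.
  by apply: lb_le_inf; first by exists m.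
by exists u.
Qed.

End SmallestEigenvalue.

(** * The trust-region subproblem *)

Section Subproblem.
Context {R : realType} {n : nat} (A : 'M[R]_n) (b d : 'rV[R]_n) (r : R).
Hypothesis A_sym : forall u v, dot (u *m A) v = dot (v *m A) u.
Hypothesis r0 : 0 < r.
Hypothesis d_le : norm2 d <= r.
Hypothesis d_min : forall d', norm2 d' <= r ->
  2^-1 * dot (d *m A) d + dot b d <= 2^-1 * dot (d' *m A) d' + dot b d'.

(** First-order optimality on the segment from [d] to [d'], which stays in the
    ball. *)
Lemma subproblem_variational d' : norm2 d' <= r ->
  0 <= dot (d *m A + b) (d' - d).
Proof.
move=> d'_le.
apply: (@ge0_of_linear_lbound _ _ (2^-1 * dot ((d' - d) *m A) (d' - d))) => t t0 t1.
have : norm2 (d + t *: (d' - d)) <= r.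
  have -> : d + t *: (d' - d) = (1 - t) *: d + t *: d'.
    by rewrite scalerBr scalerBl scale1r addrCA addrC.
  rewrite (le_trans (ler_norm2D _ _))// !norm2Z (gtr0_norm t0).
  rewrite ger0_norm ?subr_ge0//.
  have : 0 <= 1 - t by rewrite subr_ge0.
  move=> t1'; have := ler_wpM2l t1' d_le; have := ler_wpM2l (ltW t0) d'_le; lra.
move/d_min; move: (d' - d) => e.
rewrite mulmxDl -scalemxAl !dot_lin (A_sym e d) => h.
rewrite -(pmulr_rge0 _ t0); lra.
Qed.

(** Comparing with the boundary point opposite to the residual [d *m A + b]
    forces equality in Cauchy-Schwarz, so the residual is a nonpositive multiple
    of [d], and it vanishes unless [d] lies on the boundary. *)
Lemma subproblem_multiplier : exists2 mu, 0 <= mu &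
  d *m A + b = - mu *: d /\ (norm2 d = r \/ mu = 0).
Proof.
have [w wE] : exists w, w = d *m A + b by eexists.
rewrite -wE; have h : r * norm2 w <= - dot w d.
  have [w0|w0] := eqVneq (norm2 w) 0.
    by rewrite w0 (norm2_eq0 w0) dot0l oppr0 mulr0.
  have wp : 0 < norm2 w by rewrite lt_neqAle eq_sym w0 norm2_ge0.
  have := @subproblem_variational (- (r / norm2 w) *: w); rewrite -wE.
  have c0 : 0 <= r / norm2 w by rewrite divr_ge0// ltW.
  rewrite norm2Z normrN (ger0_norm c0) divfK// lexx => /(_ isT).
  rewrite dotDr dotNr dotZr -sqr_norm2.
  have -> : - (r / norm2 w) * norm2 w ^+ 2 = - (r * norm2 w) by field.
  lra.
exists (norm2 w / r); first by rewrite divr_ge0 ?norm2_ge0// ltW.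
split.
  apply/eqP; rewrite scaleNr -subr_eq0 opprK; apply/eqP/dot_eq0.
  apply/le_anti; rewrite dot_ge0 andbT.
  rewrite !(dotDl, dotDr) !(dotZl, dotZr) (dotC d w) -!sqr_norm2.
  have m0 : 0 <= norm2 w / r by rewrite divr_ge0 ?norm2_ge0// ltW.
  have e : norm2 w = norm2 w / r * r by rewrite divfK ?gt_eqF.
  move: h d_le m0 e (norm2_ge0 d).
  move: (dot w d) (norm2 d) (norm2 w) (norm2 w / r) => p N W mu.
  move=> h d_le' m0 e N0; rewrite {}e in h *.
  have h1 : 0 <= mu * (- p - r * (mu * r)) by apply: mulr_ge0; rewrite ?subr_ge0.
  have h2 : 0 <= mu ^+ 2 * (r ^+ 2 - N ^+ 2).
    by apply: mulr_ge0; rewrite ?sqr_ge0// subr_ge0 lerXn2r ?nnegrE// ltW.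
  lra.
have [->|dr] := eqVneq (norm2 d) r; first by left.
right; have dlt : norm2 d < r by rewrite lt_neqAle dr.
have := dot_le_norm2 w (- d); rewrite norm2N dotNr => h'.
have : (r - norm2 d) * norm2 w <= 0 by lra.
rewrite pmulr_rle0 ?subr_gt0// => w0.
by rewrite (@le_anti _ _ (norm2 w) 0) ?mul0r// w0 norm2_ge0.
Qed.

End Subproblem.

Section Step.
Context {R : realType} {n : nat} (f : 'rV[R]_n.+1 -> R)
  (g : 'rV[R]_n.+1 -> 'rV[R]_n.+1) (H : 'rV[R]_n.+1 -> 'M[R]_n.+1) (M : R).
Hypothesis M0 : 0 < M.
Hypothesis f_taylor : forall x d,
  `|f (x + d) - f x - (dot (g x) d + dot (d *m H x) d / 2)|
    <= M / 6 * norm2 d ^+ 3.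
Hypothesis g_taylor : forall x d,
  norm2 (g (x + d) - g x - d *m H x) <= M / 2 * norm2 d ^+ 2.
Hypothesis H_sym : forall x u v, dot (u *m H x) v = dot (v *m H x) u.
Hypothesis H_psd : forall x v, 0 <= dot (v *m H x) v.
Implicit Types (x d : 'rV[R]_n.+1).

(** The products of sigma and of r with the square root of the gradient norm are
    single parameters here, so that the subproblem is that of a plain quadratic
    model. *)
Definition solves_regularized x (tau r : R) d : Prop :=
  norm2 d <= r /\ forall d', norm2 d' <= r ->
  2^-1 * dot (d *m (H x + tau%:M)) d + dot (g x) d
    <= 2^-1 * dot (d' *m (H x + tau%:M)) d' + dot (g x) d'.

(** Everything follows from [g x + d *m H x = - (mu + tau) *: d], where [mu] is
    the multiplier.  It turns the model value into minus a quadratic form in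
    [d]; it makes [g (x + d)] equal to [- (mu + tau) *: d] up to the Taylor
    remainder; and it gives [(mu + tau) * |d| <= |g x|], since
    [H x] is positive semidefinite. *)
Lemma regularized_step x tau r d c : 0 <= tau -> 0 < r ->
  (forall v, c * dot v v <= dot (v *m H x) v + 2 * tau * dot v v) ->
  solves_regularized x tau r d ->
  [/\ f (x + d) - f x <= - (c / 2) * norm2 d ^+ 2 + M / 6 * norm2 d ^+ 3,
      norm2 (g (x + d)) <= norm2 (g x) + M / 2 * norm2 d ^+ 2 &
      norm2 d = r \/
      norm2 (g (x + d)) <= tau * norm2 d + M / 2 * norm2 d ^+ 2].
Proof.
move=> tau0 r0 hc [d_le d_min].
have sym u v : dot (u *m (H x + tau%:M)) v = dot (v *m (H x + tau%:M)) u.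
  by rewrite !mulmxDr !mul_mx_scalar !dotDl !dotZl H_sym (dotC u v).
have [mu mu0 [kkt bdry]] := subproblem_multiplier sym r0 d_le d_min.
have {kkt} kkt : g x = - ((mu + tau) *: d + d *m H x).
  have -> : g x = - (d *m (H x + tau%:M)) + - mu *: d by rewrite -kkt addKr.
  rewrite mulmxDr mul_mx_scalar scalerDl scaleNr -opprD; congr (- _).
  by rewrite addrC [_ + tau *: d]addrC addrA.
have gE : g (x + d) = (g (x + d) - g x - d *m H x) - (mu + tau) *: d.
  by rewrite -addrA -opprD [d *m H x + _]addrC -kkt subrK.
have nu0 : 0 <= mu + tau by rewrite addr_ge0.
have nd : norm2 (- ((mu + tau) *: d)) = (mu + tau) * norm2 d.
  by rewrite norm2N norm2Z ger0_norm.
have gle : norm2 (g (x + d)) <= (mu + tau) * norm2 d + M / 2 * norm2 d ^+ 2.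
  rewrite gE (le_trans (ler_norm2D _ _))// nd addrC lerD2l; exact: g_taylor.
split.
- have := f_taylor x d; rewrite ler_norml => /andP[_].
  have := hc d; rewrite {1}kkt dotNl dotDl dotZl -sqr_norm2.
  have : 0 <= mu * norm2 d ^+ 2 by rewrite mulr_ge0 ?sqr_ge0.
  lra.
- apply: (le_trans gle); rewrite lerD2r kkt norm2N.
  rewrite -(@ler_pXn2r _ 2) ?nnegrE ?mulr_ge0 ?norm2_ge0//.
  rewrite exprMn [leRHS]sqr_norm2 !(dotDl, dotDr) !(dotZl, dotZr) sqr_norm2.
  rewrite (dotC d (d *m H x)).
  have := mulr_ge0 nu0 (H_psd x d); have := dot_ge0 (d *m H x); lra.
- by case: bdry => [->|mu_0]; [left | right; rewrite mu_0 add0r in gle].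
Qed.

(** The two branches of the strategy share this analysis: [theta * s / rho] is
    the radius and [tau * rho * s] the regularization, so the branches are
    [theta = 1/2, tau = 0] and [theta = 1/4, tau = 1], with [chi = 1] and
    [chi = 2].  After the substitution [s = rho * u] each of the acceptance
    inequalities is homogeneous in [u] and becomes one of the four bounds
    relating [M] to [rho ^ 2]. *)
Lemma regularized_step_accepted x d (eta xi rho theta chi tau : R) :
  let s := Num.sqrt (norm2 (g x)) in
  0 < s -> 0 < rho -> 0 < xi -> 0 < theta -> 0 <= tau ->
  (forall v, chi * (rho * s) * dot v v
     <= dot (v *m H x) v + 2 * (tau * (rho * s)) * dot v v) ->
  M * theta <= 3 * chi * rho ^+ 2 ->
  M * theta ^+ 3 <= (3 * chi * theta ^+ 2 - 6 * eta) * rho ^+ 2 ->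
  M * theta ^+ 2 <= 2 * (xi - tau * theta) * rho ^+ 2 ->
  M * theta ^+ 2 * xi <= 2 * (1 - xi) * rho ^+ 2 ->
  solves_regularized x (tau * (rho * s)) (theta * (s / rho)) d ->
  [/\ f (x + d) <= f x,
      f (x + d) - f x <= - (eta / rho * s ^+ 3) \/
      norm2 (g (x + d)) <= xi * norm2 (g x) &
      norm2 (g (x + d)) <= xi^-1 * norm2 (g x)].
Proof.
move=> s s0 rho0 xi0 theta0 tau0 hH m1 m2 m3 m4 sol.
have u0 : 0 < s / rho by rewrite divr_gt0.
have sE : s = rho * (s / rho) by rewrite mulrC divfK ?gt_eqF.
have gE : norm2 (g x) = s ^+ 2 by rewrite sqr_sqrtr ?norm2_ge0.
have d_le := sol.1.
have [] := @regularized_step x (tau * (rho * s)) (theta * (s / rho)) d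
  (chi * (rho * s)) _ _ hH sol.
- by rewrite !mulr_ge0// ltW.
- by rewrite mulr_gt0.
rewrite gE; have := norm2_ge0 d.
have -> : eta / rho * s ^+ 3 = eta * rho ^+ 2 * (s / rho) ^+ 3.
  by field; rewrite gt_eqF.
move: d_le sE u0; move: (norm2 d) (s / rho) => e u e_le sE u0 e0.
have u2 : 0 <= u ^+ 2 by rewrite sqr_ge0.
have u3 : 0 <= u ^+ 3 by rewrite exprn_ge0// ltW.
have e2 : e ^+ 2 <= (theta * u) ^+ 2.
  by rewrite lerXn2r ?nnegrE// (le_trans e0).
have Me2 : M / 2 * e ^+ 2 <= M / 2 * theta ^+ 2 * u ^+ 2.
  by rewrite -[leRHS]mulrA -exprMn ler_wpM2l// ltW// divr_gt0.
rewrite !{}sE => fle gle bdry; split.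
- have : e ^+ 2 * (M * e) <= e ^+ 2 * (3 * chi * rho ^+ 2 * u).
    apply: ler_wpM2l; rewrite ?sqr_ge0//.
    apply: (@le_trans _ _ (M * (theta * u))); first by rewrite ler_wpM2l// ltW.
    by rewrite mulrA ler_wpM2r// ltW.
  lra.
- case: bdry => [eE|gle']; [left | right].
    by have := ler_wpM2r u3 m2; rewrite eE in fle; lra.
  apply: (le_trans gle').
  have : tau * (rho * (rho * u)) * e <= tau * (rho * (rho * u)) * (theta * u).
    by rewrite ler_wpM2l// !mulr_ge0// ltW.
  have := ler_wpM2r u2 m3; lra.
- apply: (le_trans gle); rewrite -(ler_pM2l xi0) mulVKf ?gt_eqF//.
  have := ler_wpM2r u2 m4; have := ler_wpM2l (ltW xi0) Me2; lra.
Qed.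

End Step.

(** * The acceptance thresholds *)

Section Acceptance.
Context {R : realType}.
Implicit Types (M q rho s : R).

Lemma sqrt_div_le M q rho : 0 < q -> 0 <= M -> 0 <= rho ->
  Num.sqrt (M / q) <= rho -> M <= q * rho ^+ 2.
Proof.
move=> q0 M0 rho0 h; rewrite -ler_pdivrMl// mulrC.
have Mq : 0 <= M / q by rewrite divr_ge0// ltW.
by rewrite -[leLHS](sqr_sqrtr Mq) lerXn2r ?nnegrE ?sqrtr_ge0.
Qed.

Lemma rho_maxP (eta xi gamma1 M rho : R) :
  eta < 1 / 32 -> 1 / 4 < xi -> xi < 1 -> 0 < gamma1 -> 0 < M -> 0 < rho ->
  rho_max eta xi gamma1 M / gamma1 <= rho ->
  [/\ M <= 12 * (1 - 32 * eta) * rho ^+ 2, M <= 6 * (1 - 8 * eta) * rho ^+ 2,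
      M <= (32 * xi - 8) * rho ^+ 2, M <= 8 * xi * rho ^+ 2 &
      M * xi <= 8 * (1 - xi) * rho ^+ 2].
Proof.
move=> eta_lt xi_gt xi_lt ga0 M0 rho0.
rewrite /rho_max mulrC mulKf ?gt_eqF// !ge_max => /and5P[h1 h2 h3 h4 h5].
split; apply: sqrt_div_le => //; rewrite ?(ltW M0) ?(ltW rho0)//; try lra.
by rewrite mulr_ge0 ?(ltW M0)//; lra.
Qed.

Lemma sqrt_powR32 (a : R) : 0 <= a -> a `^ (3 / 2) = Num.sqrt a ^+ 3.
Proof.
move=> a0; rewrite -{1}(sqr_sqrtr a0) -powR_mulrn ?sqrtr_ge0//.
by rewrite -powRrM (_ : 2%:R * (3 / 2) = 3%:R) ?powR_mulrn ?sqrtr_ge0//; field.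
Qed.

End Acceptance.

(** * Counting iterations with a potential *)

Section Potential.
Context {R : realType} (eta xi gamma1 gamma2 D eps P : R).
Hypotheses (eta0 : 0 < eta) (xi0 : 0 < xi) (xi1 : xi < 1).
Hypotheses (gamma1_gt1 : 1 < gamma1) (gamma2_gt1 : 1 < gamma2).
Hypotheses (D0 : 0 < D) (eps0 : 0 < eps) (P0 : 0 < P).
Implicit Types (s c u gap gn rho : R).

(** An accepted step divides the penalty by at most [gamma2], and it takes
    [log_gamma1 gamma2] rejections to undo this; the step is charged for itself
    and for these rejections. *)
Definition accept_cost : R := 1 + ln gamma2 / ln gamma1.
(** With this weight, a gain of [- ln xi] in [ln gn] pays for one accepted
    step. *)
Definition grad_weight : R := accept_cost / - ln xi.
(** The constant [c] such that a decrease step sends [u = gap + D * eps] to at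
    most [u - c * u ^ (3 / 2)]; it comes from [rho <= P] and
    [u <= 2 * D * gn]. *)
Definition decrease_rate : R := eta / (P * Num.sqrt (2 * D) ^+ 3).
(** A decrease step raises [u ^ (- 1 / 2)] by at least [decrease_rate / 2]; the
    factor 4 makes this worth two accepted steps, one of which repays the possible
    growth of the gradient norm by [xi ^-1]. *)
Definition gap_weight : R := 4 * accept_cost / decrease_rate.

Definition potential gap gn rho : R :=
  - (gap_weight / Num.sqrt (gap + D * eps)) + grad_weight * ln gn
  - ln rho / ln gamma1.

Definition iteration gap gn rho gap' gn' rho' : Prop :=
  [/\ gap' = gap, gn' = gn & rho' = gamma1 * rho] \/
  [/\ gap' <= gap, gn' <= xi^-1 * gn, rho / gamma2 <= rho' &
      gap' - gap <= - (eta / rho * Num.sqrt gn ^+ 3) \/ gn' <= xi * gn].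

Let ln_gamma1 : 0 < ln gamma1. Proof. exact: ln_gt0. Qed.
Let ln_gamma2 : 0 < ln gamma2. Proof. exact: ln_gt0. Qed.
Let ln_xi : 0 < - ln xi. Proof. by rewrite oppr_gt0 ln_lt0// xi0. Qed.

Lemma accept_cost_gt0 : 0 < accept_cost.
Proof. by rewrite addr_gt0// divr_gt0. Qed.

Lemma grad_weight_gt0 : 0 < grad_weight.
Proof. by rewrite divr_gt0// accept_cost_gt0. Qed.

Lemma decrease_rate_gt0 : 0 < decrease_rate.
Proof. by rewrite divr_gt0// mulr_gt0// exprn_gt0// sqrtr_gt0 mulr_gt0. Qed.

Lemma gap_weight_gt0 : 0 < gap_weight.
Proof. by rewrite divr_gt0 ?decrease_rate_gt0// mulr_gt0// accept_cost_gt0. Qed.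

(** The discrete form of [u' = - c u^(3/2)], whose solutions satisfy
    [(u^(-1/2))' = c / 2]; here [s] and [s'] are the square roots. *)
Lemma inv_growth s s' c : 0 < s -> 0 < s' -> 0 <= c ->
  s' ^+ 2 <= s ^+ 2 - c * s ^+ 3 -> s^-1 + c / 2 <= s'^-1.
Proof.
move=> s0 s'0 c0 h.
have h2 : s' * (2 + c * s) <= 2 * s.
  have cs0 : 0 <= c * s by rewrite mulr_ge0// ltW.
  have l0 : 0 <= s' * (2 + c * s) by rewrite mulr_ge0 ?addr_ge0// ltW.
  have r0 : 0 <= 2 * s by rewrite mulr_ge0// ltW.
  rewrite -(@ler_pXn2r _ 2) ?nnegrE//.
  have := ler_wpM2r (sqr_ge0 (2 + c * s)) h.
  have : 0 <= c ^+ 2 * s ^+ 4 by rewrite mulr_ge0 ?exprn_ge0// ltW.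
  have : 0 <= c ^+ 3 * s ^+ 5 by rewrite mulr_ge0 ?exprn_ge0// ltW.
  lra.
have -> : s^-1 + c / 2 = (2 + c * s) / (2 * s) by field; rewrite gt_eqF.
by rewrite ler_pdivrMr ?mulr_gt0// [leRHS]mulrC ler_pdivlMr// mulrC.
Qed.

(** A rejection lowers the last term by exactly 1.  An accepted step raises the
    last term by at most [accept_cost - 1]; if it shrinks the gradient, the
    second term drops by [accept_cost], and otherwise the first term drops by
    [2 * accept_cost] while the second rises by at most [accept_cost]. *)
Lemma potential_iteration gap gn rho gap' gn' rho' :
  0 <= gap -> 0 <= gap' -> 0 < gn' -> gap <= D * gn -> eps <= gn ->
  0 < rho -> rho <= P ->
  iteration gap gn rho gap' gn' rho' ->
  1 <= potential gap gn rho - potential gap' gn' rho'.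
Proof.
move=> gap0 gap'0 gn'0 gap_le gn_ge rho0 rho_le.
have gn0 : 0 < gn by exact: lt_le_trans gn_ge.
have De : 0 < D * eps by rewrite mulr_gt0.
have s0 : 0 < Num.sqrt (gap + D * eps) by rewrite sqrtr_gt0 ltr_wpDl.
have s'0 : 0 < Num.sqrt (gap' + D * eps) by rewrite sqrtr_gt0 ltr_wpDl.
have g10 : 0 < gamma1 by apply: lt_trans gamma1_gt1.
have g20 : 0 < gamma2 by apply: lt_trans gamma2_gt1.
case=> [[-> -> ->]|[gap_le' gn_le rho_ge]].
  rewrite /potential lnM ?posrE//.
  have -> : (ln gamma1 + ln rho) / ln gamma1 = 1 + ln rho / ln gamma1.
    by rewrite mulrDl divff// gt_eqF.
  lra.
have rho'0 : 0 < rho' by apply: lt_le_trans rho_ge; rewrite divr_gt0.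
have {}rho_ge : ln rho / ln gamma1 - ln rho' / ln gamma1 <= accept_cost - 1.
  have : ln rho - ln gamma2 <= ln rho'.
    by rewrite -ln_div ?posrE// ler_ln ?posrE// divr_gt0.
  move=> h; have i0 : 0 <= (ln gamma1)^-1 by rewrite invr_ge0 ltW.
  by have := ler_wpM2r i0 h; rewrite /accept_cost; lra.
have gw : grad_weight * - ln xi = accept_cost by rewrite divfK// gt_eqF.
have gwp := grad_weight_gt0; have awp := gap_weight_gt0.
have cp := decrease_rate_gt0.
rewrite /potential; case=> [dec|shr].
- have inv_s : (Num.sqrt (gap + D * eps))^-1 + decrease_rate / 2
     <= (Num.sqrt (gap' + D * eps))^-1.
    apply: inv_growth => //; first exact: ltW.
    rewrite !sqr_sqrtr ?addr_ge0// ?(ltW De)//.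
    suff : decrease_rate * Num.sqrt (gap + D * eps) ^+ 3
           <= eta / rho * Num.sqrt gn ^+ 3 by lra.
    have q0 : 0 < Num.sqrt (2 * D) by rewrite sqrtr_gt0 mulr_gt0.
    have s_le : Num.sqrt (gap + D * eps) <= Num.sqrt (2 * D) * Num.sqrt gn.
      rewrite -sqrtrM; last by rewrite mulr_ge0// ltW.
      by apply: ler_wsqrtr; have := ler_wpM2l (ltW D0) gn_ge; lra.
    have {}s_le : Num.sqrt (gap + D * eps) ^+ 3 <=
        Num.sqrt (2 * D) ^+ 3 * Num.sqrt gn ^+ 3.
      by rewrite -exprMn lerXn2r ?nnegrE ?sqrtr_ge0 ?mulr_ge0 ?sqrtr_ge0.
    apply: le_trans (ler_wpM2l (ltW cp) s_le) _.
    have -> : decrease_rate * (Num.sqrt (2 * D) ^+ 3 * Num.sqrt gn ^+ 3) =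
       eta / P * Num.sqrt gn ^+ 3.
      by rewrite /decrease_rate; field; rewrite !gt_eqF.
    rewrite ler_wpM2r ?exprn_ge0 ?sqrtr_ge0// ler_pM2l//.
    by rewrite lef_pV2 ?posrE.
  have lng : ln gn' <= - ln xi + ln gn.
    by rewrite -lnV ?posrE// -lnM ?posrE ?invr_gt0// ler_ln ?posrE// mulr_gt0 ?invr_gt0.
  have := ler_wpM2l (ltW gwp) lng; have := ler_wpM2l (ltW awp) inv_s.
  have : gap_weight * decrease_rate = 4 * accept_cost by rewrite divfK// gt_eqF.
  lra.
- have lng : ln gn' <= ln xi + ln gn.
    by rewrite -lnM ?posrE// ler_ln ?posrE// mulr_gt0.
  have s_le : (Num.sqrt (gap + D * eps))^-1 <= (Num.sqrt (gap' + D * eps))^-1.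
    by rewrite lef_pV2 ?posrE//; apply: ler_wsqrtr; rewrite lerD2r.
  have := ler_wpM2l (ltW gwp) lng; have := ler_wpM2l (ltW awp) s_le.
  lra.
Qed.

Lemma iterations_le_potential (gap gn rho : nat -> R) (N : nat) :
  (forall t, (t <= N)%N ->
     [/\ 0 <= gap t, gap t <= D * gn t, eps <= gn t, 0 < rho t & rho t <= P]) ->
  (forall t, (t < N)%N ->
     iteration (gap t) (gn t) (rho t) (gap t.+1) (gn t.+1) (rho t.+1)) ->
  N%:R <= potential (gap 0%N) (gn 0%N) (rho 0%N) - potential (gap N) (gn N) (rho N).
Proof.
elim: N => [|N IH] inv it; first by rewrite subrr.
have {}IH := IH (fun t tN => inv t (leqW tN)) (fun t tN => it t (leqW tN)).
have [g0 gle ge r0 rle] := inv N (leqnSn N).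
have [g0' _ ge' _ _] := inv N.+1 (leqnn _).
have := potential_iteration g0 g0' (lt_le_trans eps0 ge') gle ge r0 rle
  (it N (ltnSn N)).
rewrite -natr1; lra.
Qed.

Lemma potential_range gap0 gn0 rho0 gap gn rho :
  0 <= gap0 -> 0 <= gap -> eps <= gn -> 0 < rho -> rho <= P ->
  potential gap0 gn0 rho0 - potential gap gn rho <=
    gap_weight / Num.sqrt (D * eps) + grad_weight * (ln gn0 - ln eps)
    + (ln P - ln rho0) / ln gamma1.
Proof.
move=> gap00 gap_ge0 gn_ge rho_gt0 rho_le.
have awp := gap_weight_gt0; have gwp := grad_weight_gt0.
have De : 0 < D * eps by rewrite mulr_gt0.
have a0 : 0 <= gap_weight / Num.sqrt (gap0 + D * eps).
  by rewrite divr_ge0 ?sqrtr_ge0// ltW.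
have a1 : gap_weight / Num.sqrt (gap + D * eps) <= gap_weight / Num.sqrt (D * eps).
  rewrite ler_pM2l// lef_pV2 ?posrE ?sqrtr_gt0//; last by rewrite ltr_wpDl.
  by apply: ler_wsqrtr; rewrite lerDr.
have lg : ln eps <= ln gn by rewrite ler_ln ?posrE// (lt_le_trans eps0).
have lr : ln rho <= ln P by rewrite ler_ln ?posrE.
have i0 : 0 <= (ln gamma1)^-1 by rewrite invr_ge0 ltW.
have := ler_wpM2r i0 lr; have := ler_wpM2l (ltW gwp) lg.
rewrite /potential; lra.
Qed.

End Potential.

Section Bound.
Context {R : realType}
  (eta xi gamma1 gamma2 D rho0 rhomin G delta : R).
Hypotheses (eta0 : 0 < eta) (xi0 : 0 < xi) (xi1 : xi < 1).
Hypotheses (gamma1_gt1 : 1 < gamma1) (gamma2_gt1 : 1 < gamma2).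
Hypotheses (D0 : 0 < D) (rho00 : 0 < rho0) (rhomin0 : 0 < rhomin).
Hypotheses (G0 : 0 < G) (delta0 : 0 < delta).

(** The penalty may start above [rho_max], hence it is bounded by
    [rho_slack * rho_max] only. *)
Definition rho_slack : R := Num.max 1 (rho0 / rhomin).

(** One summand for each part of the potential's range: the constant and
    logarithmic terms in [eps], the logarithm of [rho_max / rhomin], and the gap
    term.  The denominators are the lower bounds of the factors that the part
    lacks among [rho_max], the initial gap and the logarithm. *)
Definition iteration_constant : R :=
  Num.sqrt G * (1 + ln (rho_slack * rhomin / rho0) / ln gamma1
                + 2 * grad_weight xi gamma1 gamma2) / (rhomin * delta ^+ 2)
  + Num.sqrt G / (rhomin * delta)
  + gap_weight eta gamma1 gamma2 D rho_slack / Num.sqrt D / delta ^+ 2.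

Lemma rho_slack_gt0 : 0 < rho_slack.
Proof. by rewrite lt_max ltr01. Qed.

Let init_ge0 : 0 <= ln (rho_slack * rhomin / rho0).
Proof.
apply: ln_ge0; rewrite ler_pdivlMr// mul1r -ler_pdivrMr//.
by rewrite le_max lexx orbT.
Qed.

Let ln_gamma1 : 0 < ln gamma1. Proof. exact: ln_gt0. Qed.

Lemma iteration_constant_gt0 : 0 < iteration_constant.
Proof.
have gw := grad_weight_gt0 xi0 xi1 gamma1_gt1 gamma2_gt1.
have aw := gap_weight_gt0 eta0 gamma1_gt1 gamma2_gt1 D0 rho_slack_gt0.
have i0 : 0 <= ln (rho_slack * rhomin / rho0) / ln gamma1.
  by rewrite divr_ge0// ltW.
rewrite /iteration_constant !addr_gt0//.
- by rewrite divr_gt0 ?mulr_gt0 ?exprn_gt0 ?sqrtr_gt0//; lra.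
- by rewrite divr_gt0 ?mulr_gt0 ?sqrtr_gt0.
- by apply: divr_gt0; [apply: divr_gt0; rewrite ?sqrtr_gt0 | rewrite exprn_gt0].
Qed.

(** Every part is multiplied up to the full product: [1 <= (G / eps) ^ (1 / 2)]
    supplies the power of [eps], also for the logarithm through [ln y <= y], and
    the lower bounds on the other factors supply the rest. *)
Lemma iteration_bound (eps gn0 rhom gap : R) :
  let L := log_base gamma1 (rhom / rhomin) in
  let P := rho_slack * rhom in
  0 < eps -> eps <= gn0 -> gn0 <= G -> rhomin <= rhom ->
  delta <= gap -> delta <= L ->
  1 + (gap_weight eta gamma1 gamma2 D P / Num.sqrt (D * eps)
       + grad_weight xi gamma1 gamma2 * (ln gn0 - ln eps)
       + (ln P - ln rho0) / ln gamma1)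
    <= iteration_constant * (rhom * gap * L * eps `^ (- (1 / 2))).
Proof.
move=> L P eps0 gn_ge gn_le rho_ge gap_ge L_ge.
have gw := grad_weight_gt0 xi0 xi1 gamma1_gt1 gamma2_gt1.
have sl := rho_slack_gt0.
have aw := gap_weight_gt0 eta0 gamma1_gt1 gamma2_gt1 D0 sl.
have rhom0 : 0 < rhom by exact: lt_le_trans rho_ge.
have gn0_gt0 : 0 < gn0 by exact: lt_le_trans gn_ge.
have se0 : 0 < Num.sqrt eps by rewrite sqrtr_gt0.
have sD0 : 0 < Num.sqrt D by rewrite sqrtr_gt0.
have sG0 : 0 < Num.sqrt G by rewrite sqrtr_gt0.
rewrite powRN div1r powR12_sqrt ?(ltW eps0)//.
set e := (Num.sqrt eps)^-1; have e0 : 0 < e by rewrite invr_gt0.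
have Ge1 : 1 <= Num.sqrt G * e.
  by rewrite ler_pdivlMr// mul1r; apply: ler_wsqrtr; exact: le_trans gn_le.
have lnle : ln gn0 - ln eps <= 2 * (Num.sqrt G * e).
  have Ge0 : 0 < Num.sqrt G * e by rewrite mulr_gt0.
  have : ln gn0 <= ln G by rewrite ler_ln ?posrE.
  have : ln G - ln eps = 2 * ln (Num.sqrt G * e).
    rewrite -ln_div ?posrE// mulr_natl -lnXn// exprMn /e exprVn.
    by rewrite !sqr_sqrtr// ltW.
  by have := ln_sublinear Ge0; lra.
have lnP : (ln P - ln rho0) / ln gamma1 =
    ln (rho_slack * rhomin / rho0) / ln gamma1 + L.
  rewrite /L /log_base -mulrDl; congr (_ / _).
  rewrite -ln_div ?posrE ?mulr_gt0// -lnM ?posrE ?divr_gt0 ?mulr_gt0//.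
  by congr ln; rewrite /P; field; rewrite !gt_eqF.
have awP : gap_weight eta gamma1 gamma2 D P / Num.sqrt (D * eps) =
    gap_weight eta gamma1 gamma2 D rho_slack / Num.sqrt D * rhom * e.
  rewrite sqrtrM ?(ltW D0)// /e /P /gap_weight /decrease_rate; field.
  by rewrite !gt_eqF// sqrtr_gt0 mulr_gt0.
rewrite awP lnP /iteration_constant.
set k := ln (rho_slack * rhomin / rho0) / ln gamma1.
have k0 : 0 <= k by rewrite divr_ge0// ltW.
move: aw gw lnle; set a := gap_weight _ _ _ _ rho_slack / Num.sqrt D.
move=> aw0; have {aw0} a0 : 0 < a by rewrite divr_gt0.
move: (grad_weight _ _ _) => w w0 lnle.
have L0 : 0 < L by exact: lt_le_trans L_ge.
have gap0 : 0 < gap by exact: lt_le_trans gap_ge.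
(* each summand divides [rhom * gap * L] by the lower bounds of the factors
   that it lacks *)
have dL : delta ^+ 2 <= gap * L by rewrite expr2 ler_pM// ltW.
have X1 : 1 <= rhom * gap * L / (rhomin * delta ^+ 2).
  rewrite ler_pdivlMr ?mulr_gt0 ?exprn_gt0// mul1r -mulrA.
  by rewrite ler_pM ?exprn_ge0// ltW.
have X2 : L <= rhom * gap * L / (rhomin * delta).
  rewrite ler_pdivlMr ?mulr_gt0// mulrC ler_pM2r//.
  by rewrite ler_pM// ltW.
have X3 : rhom <= rhom * gap * L / delta ^+ 2.
  by rewrite ler_pdivlMr ?exprn_gt0// -mulrA ler_pM2l.
have Y1 : Num.sqrt G * e * (1 + k + 2 * w) <=
   Num.sqrt G * e * (1 + k + 2 * w) * (rhom * gap * L / (rhomin * delta ^+ 2)).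
  by rewrite ler_peMr// !mulr_ge0// 1?ltW//; lra.
have Y2 : Num.sqrt G * e * L <=
   Num.sqrt G * e * (rhom * gap * L / (rhomin * delta)).
  by rewrite ler_wpM2l// mulr_ge0// ltW.
have Y3 : a * e * rhom <= a * e * (rhom * gap * L / delta ^+ 2).
  by rewrite ler_wpM2l// mulr_ge0// ltW.
have Z1 : 1 + k <= Num.sqrt G * e * (1 + k) by rewrite ler_peMl//; lra.
have Z2 : L <= Num.sqrt G * e * L by rewrite ler_peMl// ltW.
have Z3 := ler_wpM2l (ltW w0) lnle.
lra.
Qed.

End Bound.

(** * The adaptive method on a convex function *)

Lemma solves_subproblem_regularized (R : realType) (n : nat)
    (f : 'rV[R]_n.+1 -> R) x sigma r d tau r' :
  tau = sigma * Num.sqrt (norm2 (grad f x)) ->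
  r' = r * Num.sqrt (norm2 (grad f x)) ->
  solves_subproblem f x sigma r d ->
  solves_regularized (grad f) (hess f) x tau r' d.
Proof. by move=> -> ->. Qed.

Lemma convex_function_line (R : realType) (n : nat) (f : 'rV[R]_n.+1 -> R) :
  convex_function [set: 'rV[R]_n.+1] f ->
  forall x v (t : R), 0 <= t -> t <= 1 ->
    f (x + t *: v) <= f x + t * (f (x + v) - f x).
Proof.
move=> fc x v t t0 t1.
have : f (t *: (x + v) + (1 - t) *: x) <= t * f (x + v) + (1 - t) * f x.
  exact: fc (Itv01 t0 t1) (x + v) x (in_setT _) (in_setT _).
have -> : t *: (x + v) + (1 - t) *: x = x + t *: v.
  by rewrite scalerDr scalerBl scale1r addrC addrA subrK.
lra.
Qed.

Section ConvexMethod.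
Context {R : realType} {n : nat} (f : 'rV[R]_n.+1 -> R) (M : R).
Hypothesis f_convex : convex_function [set: 'rV[R]_n.+1] f.
Hypothesis f2 : twice_differentiable f.
Hypothesis M0 : 0 < M.
Hypothesis hess_lip :
  forall x y, opnorm (hess f x - hess f y) <= M * norm2 (x - y).

Let f_line x d (t : R) :
  is_derive t 1 (fun s => f (x + s *: d)) (dot (grad f (x + t *: d)) d).
Proof. exact: is_derive_line (f2.1 _). Qed.

Let grad_line x d w (t : R) :
  is_derive t 1 (fun s => dot (grad f (x + s *: d)) w)
    (dot (d *m hess f (x + t *: d)) w).
Proof. exact: is_derive_grad_line (f2.2 _). Qed.

Let f_taylor := taylor2 f_line grad_line hess_lip.
Let f_grad_taylor := grad_taylor grad_line M0 hess_lip.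
Let f_hess_sym := hess_sym f_line grad_line M0 hess_lip.
Let f_hess_psd := convex_hess_psd f_line grad_line M0 hess_lip
  (convex_function_line f_convex).

(** The link between the gradient norm and the function gap: the tangent
    inequality and Cauchy-Schwarz. *)
Lemma grad_gap x y : f x - f y <= norm2 (grad f x) * norm2 (x - y).
Proof.
have := convex_grad_ineq f_line grad_line M0 hess_lip
  (convex_function_line f_convex) x (y - x).
rewrite [x + _]addrC subrK => h; apply: le_trans (dot_le_norm2 _ _).
by rewrite -(opprB y x) dotNr; lra.
Qed.

Lemma grad_at_minimizer x : (forall y, f x <= f y) -> grad f x = 0.
Proof. exact: grad_minimizer f_line grad_line M0 hess_lip x. Qed.

Lemma lambda_min_hess_ge0 x : 0 <= lambda_min (hess f x).
Proof. by have [u [_ -> _]] := lambda_minP (f_hess_sym x). Qed.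

(** Convexity makes the eigenvalue part of the termination test hold. *)
Lemma strategy_at_small (eps rho : R) x : 0 < eps -> 0 < rho ->
  norm2 (grad f x) < eps -> strategy_at f eps rho x = None.
Proof.
move=> eps0 rho0 g_lt; rewrite /strategy_at /strategy leNgt g_lt /=.
rewrite ifT//; apply: lt_le_trans (lambda_min_hess_ge0 x).
by rewrite oppr_lt0 mulr_gt0// sqrtr_gt0.
Qed.

Lemma strategy_at_large (eps rho : R) x :
  eps <= norm2 (grad f x) -> strategy_at f eps rho x <> None.
Proof. by rewrite /strategy_at /strategy => ->; case: ifP. Qed.

Lemma accept_large_rho (eta xi gamma1 eps rho sigma r : R) x d :
  0 < eta -> eta < 1 / 32 -> 1 / 4 < xi -> xi < 1 -> 0 < gamma1 ->
  0 < eps -> eps <= norm2 (grad f x) ->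
  0 < rho -> rho_max eta xi gamma1 M / gamma1 <= rho ->
  strategy_at f eps rho x = Some (sigma, r) ->
  solves_subproblem f x sigma r d ->
  accept f eta xi eps rho x d.
Proof.
move=> eta0 eta_lt xi_gt xi_lt1 ga0 eps0 g_ge rho0 rho_ge.
have [m1 m2 m3 m4 m5] := rho_maxP eta_lt xi_gt xi_lt1 ga0 M0 rho0 rho_ge.
have g0 : 0 < norm2 (grad f x) by exact: lt_le_trans g_ge.
have s0 : 0 < Num.sqrt (norm2 (grad f x)) by rewrite sqrtr_gt0.
have xi0 : 0 < xi by lra.
have rho2 : 0 < rho ^+ 2 by rewrite exprn_gt0.
have l0 := lambda_min_hess_ge0 x.
have [_ [_ _ l_min]] := lambda_minP (f_hess_sym x).
have er : 0 <= eta * rho ^+ 2 by rewrite mulr_ge0// ltW.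
have xr : 0 <= (1 - xi) * rho ^+ 2.
  by rewrite mulr_ge0 ?subr_ge0 ?(ltW xi_lt1) ?(ltW rho2).
rewrite /strategy_at /strategy g_ge => strat sol.
suff [hf hdec hg] : [/\ f (x + d) <= f x,
      f (x + d) - f x <= - (eta / rho * Num.sqrt (norm2 (grad f x)) ^+ 3) \/
      norm2 (grad f (x + d)) <= xi * norm2 (grad f x) &
      norm2 (grad f (x + d)) <= xi^-1 * norm2 (grad f x)].
  rewrite /accept g_ge sqrt_powR32 ?norm2_ge0// hf hg andbT /=.
  exact/orP.
move: strat; case: ifP => [/orP l_big|_] [sigmaE rE].
- have {}l_big : rho * Num.sqrt (norm2 (grad f x)) <= lambda_min (hess f x).
    case: l_big => // l_neg; exfalso.
    have : 0 < rho * Num.sqrt (norm2 (grad f x)) by rewrite mulr_gt0.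
    lra.
  apply: (@regularized_step_accepted _ _ _ _ _ M M0 f_taylor f_grad_taylor
    f_hess_sym f_hess_psd x d eta xi rho 2^-1 1 0) => //; try lra.
  + move=> v; have := ler_wpM2r (dot_ge0 v) l_big; have := l_min v; lra.
  + apply: solves_subproblem_regularized sol; rewrite -?sigmaE -?rE ?mul0r//.
    by field; rewrite gt_eqF.
- apply: (@regularized_step_accepted _ _ _ _ _ M M0 f_taylor f_grad_taylor
    f_hess_sym f_hess_psd x d eta xi rho 4^-1 2 1) => //; try lra.
  + move=> v; have := f_hess_psd x v; lra.
  + apply: solves_subproblem_regularized sol; rewrite -?sigmaE -?rE ?mul1r//.
    by field; rewrite gt_eqF.
Qed.

End ConvexMethod.

Section Run.
Context {R : realType} (eta xi rho0 rhomin gamma1 gamma2 D : R).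
Hypotheses (eta_gt0 : 0 < eta) (eta_lt : eta < 1 / 32).
Hypotheses (xi_gt : 1 / 4 < xi) (xi_lt1 : xi < 1).
Hypotheses (rho0_gt0 : 0 < rho0) (rhomin_gt0 : 0 < rhomin).
Hypotheses (gamma1_gt1 : 1 < gamma1) (gamma2_gt1 : 1 < gamma2).
Hypothesis D_gt0 : 0 < D.
Context {n : nat} (f : 'rV[R]_n.+1 -> R) (M eps : R) (x0 xstar : 'rV[R]_n.+1).
Hypothesis f_convex : convex_function [set: 'rV[R]_n.+1] f.
Hypothesis f2 : twice_differentiable f.
Hypothesis M0 : 0 < M.
Hypothesis hess_lip :
  forall x y, opnorm (hess f x - hess f y) <= M * norm2 (x - y).
Hypothesis xstar_min : forall y, f xstar <= f y.
Hypothesis sublevel : forall y, f y <= f x0 -> norm2 (y - xstar) <= D.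
Hypothesis eps0 : 0 < eps.
Let rhomax := rho_max eta xi gamma1 M.
Let P := rho_slack rho0 rhomin * rhomax.
Hypothesis rhomax_ge : rhomin <= rhomax.
Context (x d : nat -> 'rV[R]_n.+1) (rho : nat -> R).
Hypothesis run : method_run f eta xi rho0 rhomin gamma1 gamma2 eps x0 x d rho.

Let gn t := norm2 (grad f (x t)).
Let gap t := f (x t) - f xstar.

Let gamma1_gt0 : 0 < gamma1. Proof. exact: lt_trans gamma1_gt1. Qed.
Let rhomax_gt0 : 0 < rhomax. Proof. exact: lt_le_trans rhomax_ge. Qed.

Lemma rhomax_le_slack : rhomax <= P.
Proof. by rewrite /P ler_peMl ?le_max ?lexx// ltW. Qed.

Lemma rho0_le_slack : rho0 <= P.
Proof.
have r0 : 0 <= rho0 / rhomin by rewrite divr_ge0// ltW.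
have e : rho0 = rho0 / rhomin * rhomin by rewrite divfK ?gt_eqF.
rewrite [leLHS]e; apply: (@le_trans _ _ (rho0 / rhomin * rhomax)).
  by rewrite ler_wpM2l.
by rewrite ler_pM2r// le_max lexx orbT.
Qed.

Lemma run_step t : eps <= gn t -> 0 < rho t -> rho t <= P ->
  [/\ f (x t.+1) <= f (x t), 0 < rho t.+1, rho t.+1 <= P &
   iteration eta xi gamma1 gamma2 (gap t) (gn t) (rho t)
     (gap t.+1) (gn t.+1) (rho t.+1)].
Proof.
move=> g_ge rho_gt0 rho_le; have [_ _ /(_ t)] := run.
case strat: (strategy_at _ _ _ _) => [[sigma r]|]; last first.
  by have := strategy_at_large (rho := rho t) g_ge.
case=> sol; rewrite /iteration /gap /gn; case: ifPn => [acc [-> ->]|rej [-> ->]].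
- move: acc; rewrite /accept g_ge => /and3P[f_le dec g_le]; split=> //.
  + by rewrite lt_max rhomin_gt0.
  + rewrite ge_max (le_trans rhomax_ge rhomax_le_slack) /=.
    apply: le_trans rho_le; rewrite ler_pdivrMr ?ler_peMr ?ltW//.
    exact: lt_trans gamma2_gt1.
  + right; split; rewrite ?lerD2r ?le_max ?lexx ?orbT//.
    case/orP: dec => dec; [left | by right].
    by move: dec; rewrite sqrt_powR32 ?norm2_ge0//; lra.
- split; rewrite ?mulr_gt0//; last by left.
  apply: le_trans rhomax_le_slack; rewrite leNgt; apply: contra rej => rho_gt.
  apply: (accept_large_rho (gamma1 := gamma1) f_convex f2 M0 hess_lip)
    strat sol => //.
  by rewrite ler_pdivrMr// [leRHS]mulrC ltW.
Qed.

(** The penalty grows only at rejections, which occur below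
    [rho_max / gamma1]. *)
Lemma run_invariant N : (forall t, (t < N)%N -> eps <= gn t) ->
  [/\ f (x N) <= f x0, 0 < rho N & rho N <= P].
Proof.
elim: N => [_|N IH g_ge].
  by have [-> -> _] := run; split=> //; exact: rho0_le_slack.
have [f_le r0 rP] := IH (fun t tN => g_ge t (leqW tN)).
have [f_le' r0' rP' _] := run_step (g_ge N (ltnSn N)) r0 rP.
by split=> //; exact: le_trans f_le.
Qed.

Lemma run_gap_le t : f (x t) <= f x0 -> gap t <= D * gn t.
Proof.
move=> f_le; have := grad_gap f_convex f2 M0 hess_lip (x t) xstar.
move=> /le_trans; apply; rewrite mulrC ler_wpM2r ?norm2_ge0//; exact: sublevel.
Qed.

Lemma run_length N : (forall t, (t <= N)%N -> eps <= gn t) ->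
  N%:R <= gap_weight eta gamma1 gamma2 D P / Num.sqrt (D * eps)
          + grad_weight xi gamma1 gamma2 * (ln (gn 0%N) - ln eps)
          + (ln P - ln rho0) / ln gamma1.
Proof.
move=> g_ge.
have xi0 : 0 < xi by apply: lt_trans xi_gt; rewrite divr_gt0.
have P0 : 0 < P by exact: lt_le_trans rhomax_le_slack.
have gap_ge0 t : 0 <= gap t by rewrite subr_ge0.
have inv t : (t <= N)%N -> [/\ f (x t) <= f x0, 0 < rho t & rho t <= P].
  move=> tN; apply: run_invariant => s st; apply: g_ge.
  exact: leq_trans (ltnW st) tN.
have rho_start : rho 0%N = rho0 by have [] := run.
have [_ rN rNP] := inv N (leqnn N).
apply: (@le_trans _ _ (potential eta xi gamma1 gamma2 D eps P (gap 0%N) (gn 0%N)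
  (rho 0%N) - potential eta xi gamma1 gamma2 D eps P (gap N) (gn N) (rho N))).
  apply: (iterations_le_potential (P := P)) => //.
    move=> t tN; have [fle r0 rP] := inv t tN.
    by split=> //; [exact: run_gap_le | exact: g_ge].
  move=> t tN; have [fle r0 rP] := inv t (ltnW tN).
  by have [] := run_step (g_ge t (ltnW tN)) r0 rP.
by rewrite -rho_start; apply: potential_range => //; exact: g_ge.
Qed.

End Run.

(* [C] is the constant of both O's.  It depends on the parameters of the
   method, on [D], on an upper bound [G] of the initial gradient norm and on a
   lower bound [delta] that keeps the factors f(x0) - f* (when nonzero) and
   log(rho_max / rho_min) away from 0; it depends neither on [eps] nor on [M],
   the dimension, [f], [x0] or the run. *)
Theorem theorem4p2 (R : realType)
    (eta xi rho0 rhomin gamma1 gamma2 D G delta : R)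
    (eta_gt0 : 0 < eta) (eta_lt : eta < 1 / 32)
    (xi_gt : 1 / 4 < xi) (xi_lt1 : xi < 1)
    (rho0_gt0 : 0 < rho0) (rhomin_gt0 : 0 < rhomin)
    (gamma1_gt1 : 1 < gamma1) (gamma2_gt1 : 1 < gamma2)
    (D_gt0 : 0 < D) (delta_gt0 : 0 < delta) :
  exists2 C : R, 0 < C &
    forall (n : nat) (f : 'rV[R]_n.+1 -> R) (M : R) (x0 xstar : 'rV[R]_n.+1),
      let fstar := inf (range f) in
      let rhomax := rho_max eta xi gamma1 M in
      convex_function [set: 'rV[R]_n.+1] f ->
      twice_differentiable f ->
      has_lbound (range f) ->
      0 < M ->
      (forall x y, opnorm (hess f x - hess f y) <= M * norm2 (x - y)) ->
      (forall x, f xstar <= f x) ->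
      (forall x, f x <= f x0 -> norm2 (x - xstar) <= D) ->
      norm2 (grad f x0) <= G ->
      (f x0 != fstar -> delta <= f x0 - fstar) ->
      delta <= log_base gamma1 (rhomax / rhomin) ->
    forall eps : R, 0 < eps ->
    forall (x d : nat -> 'rV[R]_n.+1) (rho : nat -> R),
      method_run f eta xi rho0 rhomin gamma1 gamma2 eps x0 x d rho ->
    exists T : nat,
      [/\ forall t, (t < T)%N -> strategy_at f eps (rho t) (x t) <> None,
          strategy_at f eps (rho T) (x T) = None,
          T%:R <= C * (rhomax * (f x0 - fstar)
                       * log_base gamma1 (rhomax / rhomin) * eps `^ (- (1 / 2)))
        & f (x T) - fstar <= C * eps].
Proof.
have xi0 : 0 < xi by lra.
pose G' := Num.max G 1.
have G'0 : 0 < G' by rewrite lt_max ltr01 orbT.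
pose C1 := iteration_constant eta xi gamma1 gamma2 D rho0 rhomin G' delta.
have C1_gt0 : 0 < C1 by exact: iteration_constant_gt0.
exists (C1 + D); first by rewrite addr_gt0.
move=> n f M x0 xstar fstar rhomax f_convex f2 f_lb M0 hess_lip xstar_min
  sublevel gn_le gap_ge L_ge eps eps0 x d rho run.
have fstarE : fstar = f xstar.
  apply/le_anti/andP; split; first by apply: ge_inf => //; exists xstar.
  by apply: lb_le_inf => [|_ [y _ <-]]; first by exists (f xstar), xstar.
have ln_gamma1 : 0 < ln gamma1 by exact: ln_gt0.
have rhomax_ge : rhomin <= rhomax.
  rewrite leNgt; apply/negP => lt_min.
  have : ln (rhomax / rhomin) <= 0.
    by rewrite ln_le0// ler_pdivrMr// mul1r ltW.
  have : 0 < ln (rhomax / rhomin).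
    by rewrite -(@pmulr_lgt0 _ (ln gamma1)^-1) ?invr_gt0// (lt_le_trans delta_gt0).
  lra.
have rhomax_gt0 : 0 < rhomax by exact: lt_le_trans rhomax_ge.
set L := log_base _ _ in L_ge *; have L_gt0 : 0 < L by exact: lt_le_trans L_ge.
have invariant := run_invariant eta_gt0 eta_lt xi_gt xi_lt1 rho0_gt0 rhomin_gt0
  gamma1_gt1 gamma2_gt1 xstar f_convex f2 M0 hess_lip eps0 rhomax_ge run.
set B := C1 * (rhomax * (f x0 - fstar) * L * eps `^ (- (1 / 2))).
have gap0 : 0 <= f x0 - fstar by rewrite fstarE subr_ge0.
have rate_ge0 : 0 <= rhomax * (f x0 - fstar) * L * eps `^ (- (1 / 2)).
  exact: mulr_ge0 (mulr_ge0 (mulr_ge0 (ltW rhomax_gt0) gap0) (ltW L_gt0))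
    (powR_ge0 _ _).
have B_ge0 : 0 <= B by exact: mulr_ge0 (ltW C1_gt0) rate_ge0.
have length_le N : (forall t, (t <= N)%N -> eps <= norm2 (grad f (x t))) ->
    N.+1%:R <= B.
  move=> g_ge; rewrite -natr1 addrC.
  have := run_length eta_gt0 eta_lt xi_gt xi_lt1 rho0_gt0 rhomin_gt0 gamma1_gt1
    gamma2_gt1 D_gt0 f_convex f2 M0 hess_lip xstar_min sublevel eps0 rhomax_ge
    run g_ge.
  have x_start : x 0%N = x0 by have [] := run.
  have g0_ge := g_ge 0%N isT; rewrite x_start in g0_ge *.
  move=> /(lerD (lexx 1)) len; apply: (le_trans len) => {len}.
  apply: iteration_bound => //; first by rewrite le_max gn_le.
  (* [f x0 = fstar] would give a zero gradient, hence termination at once *)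
  apply: gap_ge; apply/negP => /eqP f0.
  have := grad_at_minimizer f2 M0 hess_lip (x := x0).
  rewrite f0 fstarE => /(_ xstar_min) g0.
  by move: g0_ge; rewrite g0 norm2_0 leNgt eps0.
have [T0 T0_small] : exists t, norm2 (grad f (x t)) < eps.
  apply: contrapT => none.
  have big t : eps <= norm2 (grad f (x t)).
    by rewrite leNgt; apply/negP => h; apply: none; exists t.
  have := length_le (Num.bound B) (fun t _ => big t).
  rewrite leNgt; apply/negP; rewrite negbK.
  by apply: (lt_le_trans (archi_boundP B_ge0)); rewrite ler_nat.
have exT : exists t, norm2 (grad f (x t)) < eps by exists T0.
case: (ex_minnP exT) => T T_small T_min.
have g_ge t : (t < T)%N -> eps <= norm2 (grad f (x t)).
  by move=> tT; rewrite leNgt; apply/negP => /T_min; rewrite leqNgt tT.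
have [f_le rho_gt0 _] := invariant T g_ge.
exists T; split.
- by move=> t tT; apply: strategy_at_large; exact: g_ge.
- exact: (strategy_at_small f_convex f2 M0 hess_lip).
- apply: (@le_trans _ _ B); last first.
    by apply: ler_wpM2r; rewrite // lerDl ltW.
  case: T g_ge {T_small T_min f_le rho_gt0} => [//|N] g_ge.
  by apply: length_le => t tN; exact: g_ge.
- rewrite fstarE.
  apply: (le_trans (run_gap_le f_convex f2 M0 hess_lip sublevel f_le)).
  by rewrite ler_pM ?norm2_ge0 ?(ltW D_gt0) ?lerDr ?(ltW C1_gt0) ?(ltW T_small).
Qed.
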